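(* Let $\Delta$ be a flag simplicial complex and suppose that $\tilde U$ is a binary geometry for $\Delta$. Then $\Delta$ is a pseudomanifold.
   Context: A simplicial complex $\Delta$ on $[n]=\{1,\dots,n\}$ is a non-empty collection of subsets of $[n]$ (called faces) closed under taking subsets. Its dimension is the size of its largest face minus one (and the dimension of a face $F$ is $|F|-1$). Facets are the maximal faces; $\Delta$ is pure if all facets have the same dimension. A pure $d$-dimensional simplicial complex is a pseudomanifold if every $(d-1)$-dimensional face is contained in exactly two facets. $\Delta$ is a flag complex if $\{i\}\in\Delta$ for each $i\in[n]$, and for $r>2$, $\{a_1,\dots,a_r\}\in\Delta$ whenever all pairs $\{a_i,a_j\}\in\Delta$. Write $i\sim j$ (compatible) if $\{i,j\}\in\Delta$, and $i\not\sim j$ otherwise (so $i\sim i$). For $S\subset[n]$ let $H_S\subset\mathbb{C}^n$ be the coordinate subspace where $u_s=0$ for all $s\in S$. A binary geometry for a flag complex $\Delta$ on $[n]$ is an affine algebraic variety $\tilde U\subset\mathbb{C}^n$ (coordinates $u_1,\dots,u_n$) of dimension $\dim\tilde U=\dim\Delta+1$ cut out by $n$ equations of the form $$R_i:=u_i+\prod_{j\,:\,j\not\sim i}u_j^{a_{ij}}-1=0,\qquad i=1,\dots,n,$$ for integers $a_{ij}>0$ (an empty product equals $1$), such that: for a subset $S\subset[n]$, the subvariety $\tilde U_S:=\tilde U\cap H_S$ is non-empty exactly when $S\in\Delta$, and in this case $\tilde U_S$ is irreducible and pure of codimension $|S|$ in $\tilde U$. *)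

(* Defs.v *)
From mathcomp Require Import all_boot all_order all_algebra.
From mathcomp Require Import mpoly complex.
From mathcomp Require Import boolp classical_sets reals.

Set Implicit Arguments.
Unset Strict Implicit.
Unset Printing Implicit Defensive.

Import Order.TTheory GRing.Theory Num.Theory.

Local Open Scope classical_set_scope.
Local Open Scope ring_scope.

Section SimplicialComplexes.

Variable n : nat.

Implicit Types (Delta : {set {set 'I_n}}) (F G : {set 'I_n}).

(* The vertex set [n] = {1, ..., n} is represented by 'I_n = {0, ..., n-1}. *)
Definition simplicial_complex Delta : Prop :=
  (exists F, F \in Delta) /\
  (forall F G, F \in Delta -> G \subset F -> G \in Delta).

(* Dimensions are integers, since the empty face has dimension -1. *)
Definition face_dim F : int := #|F|%:Z - 1.

Definition complex_dim Delta : int := (\max_(F in Delta) #|F|)%N%:Z - 1.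

Definition facet Delta F : bool :=
  (F \in Delta) && [forall G in Delta, (F \subset G) ==> (G == F)].

Definition pure_complex Delta : Prop :=
  forall F G, facet Delta F -> facet Delta G -> face_dim F = face_dim G.

Definition pseudomanifold Delta : Prop :=
  pure_complex Delta /\
  (forall G, G \in Delta -> face_dim G = complex_dim Delta - 1 ->
     #|[set F : {set 'I_n} | facet Delta F & G \subset F]%SET| = 2%N).

Definition compatible Delta (i j : 'I_n) : bool := [set i; j]%SET \in Delta.

Definition flag_complex Delta : Prop :=
  [/\ simplicial_complex Delta,
      forall i, [set i]%SET \in Delta
    & forall F, (2 < #|F|)%N ->
        (forall i j, i \in F -> j \in F -> i != j -> compatible Delta i j) ->
        F \in Delta].

End SimplicialComplexes.

Section ZariskiTopology.

Variables (K : fieldType) (n : nat).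

Implicit Types (X Y Z W : set 'rV[K]_n) (P : set {mpoly K[n]}).

Definition zero_locus P : set 'rV[K]_n :=
  [set u | forall p, P p -> p.@[u 0] = 0].

Definition zariski_closed X : Prop := exists P, X = zero_locus P.

(* Irreducibility for the topology induced on X. *)
Definition irreducible X : Prop :=
  X !=set0 /\
  (forall Y Z, zariski_closed Y -> zariski_closed Z ->
     X `<=` Y `|` Z -> X `<=` Y \/ X `<=` Z).

Definition irreducible_component X Z : Prop :=
  [/\ irreducible Z, Z `<=` X
    & forall W, irreducible W -> Z `<=` W -> W `<=` X -> W = Z].

(* A chain Z 0 < Z 1 < ... < Z k of length k. *)
Definition irreducible_chain X (k : nat) : Prop :=
  exists Z : nat -> set 'rV[K]_n,
    (forall i, (i <= k)%N ->
       [/\ zariski_closed (Z i), irreducible (Z i) & Z i `<=` X]) /\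
    (forall i, (i < k)%N -> Z i `<` Z i.+1).

(* Krull dimension of a closed set; the empty set has none. *)
Definition has_dim X (d : nat) : Prop :=
  irreducible_chain X d /\ (forall k, irreducible_chain X k -> (k <= d)%N).

(* The codimension of Z in X is dim X - dim Z. *)
Definition pure_codim X Y (c : nat) : Prop :=
  forall Z, irreducible_component Y Z ->
    exists d e : nat, [/\ has_dim X d, has_dim Z e & (e + c)%N = d].

End ZariskiTopology.

Section BinaryGeometries.

Variables (K : fieldType) (n : nat).

Definition coord_subspace (S : {set 'I_n}) : set 'rV[K]_n :=
  [set u | forall s, s \in S -> u 0 s = 0].

Definition binary_equation (Delta : {set {set 'I_n}})
    (a : 'I_n -> 'I_n -> nat) (i : 'I_n) : {mpoly K[n]} :=
  'X_i + \prod_(j | ~~ compatible Delta j i) 'X_j ^+ a i j - 1.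

(* U is a set of points: irreducibility and dimension only depend on the
   underlying topological space.  The values a i j for compatible i, j do not
   enter the equations and are unconstrained. *)
Definition binary_geometry (Delta : {set {set 'I_n}})
    (U : set 'rV[K]_n) : Prop :=
  [/\ exists a : 'I_n -> 'I_n -> nat,
        (forall i j, ~~ compatible Delta j i -> (0 < a i j)%N) /\
        U = zero_locus (range (binary_equation Delta a)),
      exists d : nat, has_dim U d /\ d%:Z = complex_dim Delta + 1
    & forall S : {set 'I_n},
        (U `&` coord_subspace S !=set0 <-> S \in Delta) /\
        (S \in Delta ->
           irreducible (U `&` coord_subspace S) /\
           pure_codim U (U `&` coord_subspace S) #|S|)].

End BinaryGeometries.

(* Main.v *)
Require Import Defs.
From mathcomp Require Import all_boot all_order all_algebra.
From mathcomp Require Import mpoly complex.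
From mathcomp Require Import boolp classical_sets reals.
From mathcomp Require Import ring zify.

(** Write [D] for the largest size of a face and [U_S] for the intersection of
    [U] with the coordinate subspace of [S].

    Setting [u_j = 0] forces [u_i = 1] for every [i] incompatible with [j].
    In a flag complex, a vertex [i] that does not extend a face [F] is
    incompatible with a member of [F] ([nonface_incompatible]), so that
    [u_i = 1] on [U_F] ([stratum_coord1]).  If [F] is a facet this fixes all
    the coordinates: [U_F] is a point, and since it has dimension [D - |F|],
    [F] has size [D] ([facet_card]).  Hence the complex is pure.

    Now let [|G| = D - 1].  The facets over [G] are the [i |: G] for [i] in the
    set [L] of vertices of the link ([card_facets_over]), and two vertices of
    [L] are never compatible, as they would give a face of size [D + 1].  Hence
    [X = U_G] is irreducible and on it the remaining coordinates satisfy
    [u_j + \prod_(k in L | k != j) u_k ^+ a j k = 1] for [j] in [L].  It must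
    be shown that such equations, on an irreducible [X] on which [u_i] has a
    zero without vanishing identically, force [|L| = 2] ([card_link]).

    Fix [i] in [L] and put [t = u_i].  For [j <> i] the [j]-th equation says
    that [u_j = 1 - t ^+ a j i * M_j], where [M_j], a product of such
    coordinates, is 1 modulo [t]; hence [u_j = 1 - t ^+ a j i + ...].
    Substituting in the [i]-th equation [1 - t = \prod_j u_j ^+ a i j] and
    comparing the coefficients of [t] shows that the [a i j] with [a j i = 1]
    add up to 1: exactly one [j0] has [a j0 i = 1], and [a i j0 = 1].
    Suppose that [L] has further elements, and let [m] be the least [a j i]
    among them.  Then [M_j0] is 1 modulo [t ^+ m], thus [u_j0 = 1 - t] modulo
    [t ^+ m.+1], and the [i]-th equation becomes
    [1 - t = (1 - t) * \prod_(j <> j0) u_j ^+ a i j] modulo [t ^+ m.+1].  But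
    the last product is [1 - c * t ^+ m + ...], where [c] is the sum of the
    positive integers [a i j] over the [j] with [a j i = m]: a contradiction.

    No power series are needed: working modulo [t ^+ k] means divisibility by
    [t ^+ k] among polynomial functions on [X].  Irreducibility of [X] allows
    one to cancel powers of [t], and the zero of [t] shows that no nonzero
    constant is divisible by [t] ([order_ge_const]). *)

Set Implicit Arguments.
Unset Strict Implicit.
Unset Printing Implicit Defensive.

Import Order.TTheory GRing.Theory Num.Theory.

(** * Polynomial functions modulo powers of one of them *)

Section LocalExpansions.

Local Open Scope classical_set_scope.
Local Open Scope ring_scope.

Variables (K : numFieldType) (n : nat) (X : set 'rV[K]_n) (t : {mpoly K[n]}).

Implicit Types (f g h x y : {mpoly K[n]}) (k m c d : nat).

(** Divisibility by [t ^+ k] in the ring of polynomial functions on [X], kept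
    at the level of polynomials so as not to form the quotient by the ideal of
    [X]. *)
Definition order_ge k f : Prop :=
  exists h, forall u, X u -> f.@[u 0] = (t ^+ k * h).@[u 0].

Lemma order_ge_eq k f g :
  (forall u, X u -> f.@[u 0] = g.@[u 0]) -> order_ge k f -> order_ge k g.
Proof. by move=> fg [h fh]; exists h => u Xu; rewrite -fg ?fh. Qed.

Lemma order_geD k f g : order_ge k f -> order_ge k g -> order_ge k (f + g).
Proof.
move=> [h fh] [h' gh']; exists (h + h') => u Xu.
by rewrite mulrDr !mevalD fh ?gh'.
Qed.

Lemma order_geM k m f g :
  order_ge k f -> order_ge m g -> order_ge (k + m) (f * g).
Proof.
move=> [h fh] [h' gh']; exists (h * h') => u Xu.
by rewrite exprD mulrACA 2!mevalM fh ?gh'.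
Qed.

Lemma order_ge0 f : order_ge 0 f.
Proof. by exists f => u _; rewrite mul1r. Qed.

Lemma order_geMl k f g : order_ge k g -> order_ge k (f * g).
Proof. exact: (order_geM (order_ge0 f)). Qed.

Lemma order_geN k f : order_ge k f -> order_ge k (- f).
Proof. by rewrite -mulN1r; exact: order_geMl. Qed.

Lemma order_ge_exp k : order_ge k (t ^+ k).
Proof. by exists 1 => u _; rewrite mulr1. Qed.

Lemma order_ge_leq k m f : (k <= m)%N -> order_ge m f -> order_ge k f.
Proof.
move=> km [h fh]; exists (t ^+ (m - k) * h) => u Xu.
by rewrite mulrA -exprD subnKC ?fh.
Qed.

(** The coefficient [c] is a natural number because the expansions in view are
    those of products of factors [1 - t ^+ m + ...]: their coefficients add up
    without cancellation, so that they vanish only when each of them does. *)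
Definition expands m c x : Prop := order_ge m.+1 (1 - x - c%:R * t ^+ m).

Lemma expands_order m c x : expands m c x -> order_ge m (1 - x).
Proof.
move=> /(order_ge_leq (leqnSn m)) xc.
rewrite -[1 - x](subrK (c%:R * t ^+ m)); apply: order_geD xc _.
exact/order_geMl/order_ge_exp.
Qed.

Lemma expands1 m : expands m 0 1.
Proof.
rewrite /expands (_ : _ - _ = 0 * t ^+ m.+1); last by ring.
exact/order_geMl/order_ge_exp.
Qed.

(** The cross terms have order at least [m + m], which exceeds [m] only
    because [m] is positive. *)
Lemma expandsM m c d x y : (0 < m)%N ->
  expands m c x -> expands m d y -> expands m (c + d) (x * y).
Proof.
move=> m0 xc yd.
rewrite /expands (_ : _ - _ = (1 - x - c%:R * t ^+ m) +
  x * (1 - y - d%:R * t ^+ m) + - (d%:R * (t ^+ m * (1 - x)))); last first.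
  by rewrite natrD; ring.
apply: order_geD; first by apply: order_geD xc _; exact: order_geMl.
apply/order_geN/order_geMl/(@order_ge_leq _ (m + m)); first lia.
exact: order_geM (order_ge_exp m) (expands_order xc).
Qed.

Lemma expandsX m c x e : (0 < m)%N ->
  expands m c x -> expands m (c * e) (x ^+ e).
Proof.
move=> m0 xc; elim: e => [|e IHe]; first by rewrite muln0; exact: expands1.
by rewrite mulnS exprS; exact: expandsM.
Qed.

Lemma expands_prod (I : finType) (P : pred I) m (c : I -> nat)
    (x : I -> {mpoly K[n]}) : (0 < m)%N ->
  (forall j, P j -> expands m (c j) (x j)) ->
  expands m (\sum_(j | P j) c j)%N (\prod_(j | P j) x j).
Proof.
move=> m0 xc; apply: (big_ind2 (fun d y => expands m d y)) => //.
  exact: expands1.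
by move=> d y d' y' yd yd'; exact: expandsM.
Qed.

Lemma order_ge_1prod (I : finType) (P : pred I) m (x : I -> {mpoly K[n]})
    (e : I -> nat) :
  (forall j, P j -> order_ge m (1 - x j)) ->
  order_ge m (1 - \prod_(j | P j) x j ^+ e j).
Proof.
move=> x1.
have ord1 : order_ge m (1 - 1).
  by rewrite (_ : 1 - 1 = 0 * t ^+ m); [exact/order_geMl/order_ge_exp | ring].
have ordM f g : order_ge m (1 - f) -> order_ge m (1 - g) ->
    order_ge m (1 - f * g).
  move=> of1 og1; rewrite (_ : 1 - _ = (1 - f) + f * (1 - g)); last by ring.
  by apply: order_geD of1 _; exact: order_geMl.
apply: (big_ind (fun y => order_ge m (1 - y))) => // j Pj.
elim: (e j) => // k IHk; rewrite exprS; exact: ordM (x1 j Pj) IHk.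
Qed.

Hypothesis X_irr : irreducible X.
Hypothesis t_neq0 : ~ (forall u, X u -> t.@[u 0] = 0).
Hypothesis t_zero : exists2 p, X p & t.@[p 0] = 0.

(** If [c * t ^+ m = t ^+ m.+1 * h] on [X], then [X] is covered by the zeros of
    [t] and those of [c - t * h].  By irreducibility it lies in the latter,
    and evaluating at a zero of [t] gives [c = 0]. *)
Lemma order_ge_const m (c : K) : order_ge m.+1 (c%:MP * t ^+ m) -> c = 0.
Proof.
move=> [h ch]; have [p Xp tp] := t_zero.
have zc f : zariski_closed [set u : 'rV[K]_n | f.@[u 0] = 0].
  exists [set f]; apply/seteqP; split => u /=; first by move=> fu g ->.
  by apply.
have [|Xt|Xc] := X_irr.2 _ _ (zc t) (zc (c%:MP - t * h)).
- move=> u Xu; have := ch u Xu.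
  rewrite !mevalM !rmorphXn mevalC => /eqP.
  rewrite -subr_eq0 exprSr -mulrA mulrC -mulrBr mulf_eq0 expf_eq0.
  case/orP=> [|/eqP].
    by move=> /andP[_ /eqP tu]; left.
  by move=> e; right; rewrite /= mevalB mevalM mevalC.
- by case: t_neq0.
- by have := Xc p Xp; rewrite /= mevalB mevalM mevalC tp mul0r subr0.
Qed.

(** Natural numbers are told apart by their images in [K], which has
    characteristic zero. *)
Lemma expands_inj m c d x : expands m c x -> expands m d x -> c = d.
Proof.
move=> xc /order_geN xd; apply/eqP; rewrite -(eqr_nat K) -subr_eq0; apply/eqP.
apply: (@order_ge_const m).
have := order_geN (order_geD xc xd); apply: order_ge_eq => u _; congr (_.@[_]).
by rewrite mpolyCB !mpolyC_nat; ring.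
Qed.

End LocalExpansions.

(** * The equations of a zero-dimensional link *)

Section ZeroDimensionalLink.

Local Open Scope classical_set_scope.
Local Open Scope ring_scope.

Variables (K : numFieldType) (n : nat) (X : set 'rV[K]_n).
Variables (L : {set 'I_n}) (a : 'I_n -> 'I_n -> nat).

Hypothesis a_gt0 : forall j k, j \in L -> k \in L -> j != k -> (0 < a j k)%N.
Hypothesis X_eq : forall u, X u -> forall j, j \in L ->
  u 0 j + \prod_(k in L | k != j) u 0 k ^+ a j k = 1.

Variable i : 'I_n.
Hypothesis iL : i \in L.

Let t : {mpoly K[n]} := 'X_i.

(** The cofactor of the power of [t] in the product occurring in the [j]-th
    equation. *)
Definition residual_monomial j : {mpoly K[n]} :=
  \prod_(k in L :\ i | k != j) 'X_k ^+ a j k.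

Lemma coord_link_equation j u : j \in L :\ i -> X u ->
  ('X_j : {mpoly K[n]}).@[u 0] = (1 - t ^+ a j i * residual_monomial j).@[u 0].
Proof.
rewrite in_setD1 => /andP[ji jL] Xu.
rewrite mevalB mevalM rmorph1 !rmorphXn rmorph_prod /= !mevalXU.
rewrite -[X in _ = X - _](X_eq Xu jL) (bigD1 i) /=; last by rewrite iL eq_sym.
rewrite -[LHS](addrK (u 0 i ^+ a j i * \prod_(k in L | (k != j) && (k != i))
  u 0 k ^+ a j k)).
congr (_ + _ * _ - _ * _); apply: eq_big => [k|k _]; rewrite ?andbA //.
  by rewrite in_setD1 andbAC (andbC (k \in L)).
by rewrite rmorphXn /= mevalXU.
Qed.

Lemma prod_link u : X u ->
  (\prod_(k in L :\ i) 'X_k ^+ a i k : {mpoly K[n]}).@[u 0] = (1 - t).@[u 0].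
Proof.
move=> Xu; rewrite mevalB rmorph1 rmorph_prod /= mevalXU.
rewrite -[X in _ = X - _](X_eq Xu iL) addrAC subrr add0r.
apply: eq_big => [k|k _]; first by rewrite in_setD1 andbC.
by rewrite rmorphXn /= mevalXU.
Qed.

Lemma coord_order j : j \in L :\ i -> order_ge X t (a j i) (1 - 'X_j).
Proof.
move=> jJ; exists (residual_monomial j) => u Xu.
by rewrite mevalB rmorph1 (coord_link_equation jJ Xu) mevalB rmorph1 subKr.
Qed.

Lemma link_a_gt0 j : j \in L :\ i -> (0 < a j i)%N.
Proof. by rewrite in_setD1 => /andP[ji jL]; exact: a_gt0. Qed.

(** [1 - 'X_j] is [t ^+ a j i] times a product of coordinates, each of which is
    1 modulo [t]. *)
Lemma coord_expands m j : (0 < m)%N -> j \in L :\ i -> (m <= a j i)%N ->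
  expands X t m (a j i == m) 'X_j.
Proof.
move=> m0 jJ; rewrite leq_eqVlt eq_sym /expands.
case: eqP => [am _|_ /= am]; last first.
  by rewrite mul0r subr0; exact: order_ge_leq am (coord_order jJ).
have co : order_ge X t 1 (1 - residual_monomial j).
  apply: order_ge_1prod => k /andP[kJ _].
  exact: order_ge_leq (link_a_gt0 kJ) (coord_order kJ).
have := order_geN (order_geM (order_ge_exp X t m) co); rewrite addn1.
apply: order_ge_eq => u Xu; rewrite !mevalB (coord_link_equation jJ Xu) am.
by rewrite mevalN !mevalM !mevalB mevalM !rmorph1; ring.
Qed.

Hypothesis X_irr : irreducible X.
Hypothesis X_nsub : ~ (forall u, X u -> u 0 i = 0).
Hypothesis X_zero : exists2 p, X p & p 0 i = 0.

Let t_neq0 : ~ (forall u, X u -> t.@[u 0] = 0).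
Proof. by move=> t0; apply: X_nsub => u /t0; rewrite mevalXU. Qed.

Let t_zero : exists2 p, X p & t.@[p 0] = 0.
Proof. by have [p Xp pi] := X_zero; exists p => //; rewrite mevalXU. Qed.

(** Two expansions of the product of the [u_j ^+ a i j], first at order 1, then
    at the next order [m] at which a coordinate other than [u_j0]
    contributes. *)
Lemma card_link : #|L| = 2%N.
Proof.
have prod1 : expands X t 1 1 (\prod_(k in L :\ i) 'X_k ^+ a i k).
  exists 0 => u Xu.
  by rewrite !mevalB (prod_link Xu) mevalB !mevalM rmorph1 raddf0 expr1; ring.
(* The product is [1 - t] on [X]; compare with its expansion at order 1. *)
have /eqP : (\sum_(j in L :\ i) (a j i == 1) * a i j = 1)%N.
  apply: (expands_inj X_irr t_neq0 t_zero _ prod1).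
  apply: expands_prod => // j jJ; apply: expandsX => //.
  by apply: coord_expands => //; exact: link_a_gt0.
case/sum_nat_eq1 => j0 [j0J /eqP]; rewrite muln_eq1 => /andP[].
rewrite eqb1 => /eqP aj0 /eqP aj0' j0_uniq.
(* The claim is that no vertex besides [i] and [j0] is left. *)
pose S := L :\ i :\ j0.
have [S0|[k0 k0S]] := set_0Vmem S.
  by rewrite (cardsD1 i) iL (cardsD1 j0) j0J -/S S0 cards0.
exfalso.
have [j1 j1S j1_min] : exists2 j1, j1 \in S &
    forall j, j \in S -> (a j1 i <= a j i)%N.
  by case: (arg_minnP (fun j => a j i) k0S) => j1; exists j1.
set m := a j1 i in j1_min.
have SJ j : j \in S -> j \in L :\ i by rewrite in_setD1 => /andP[].
have m0 : (0 < m)%N by exact/link_a_gt0/SJ.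
pose Q : {mpoly K[n]} := \prod_(k in S) 'X_k ^+ a i k.
have Qc : expands X t m (\sum_(k in S) (a k i == m) * a i k)%N Q.
  apply: expands_prod => // j jS; apply: expandsX => //.
  by apply: coord_expands (SJ j jS) (j1_min j jS).
have oM : order_ge X t m (1 - residual_monomial j0).
  apply: order_ge_1prod => k /andP[kJ kj0].
  by apply: order_ge_leq (coord_order kJ); apply: j1_min;
    rewrite in_setD1 kj0 kJ.
(* On [X], [1 - t = (1 - t * M) * Q] with [M] the residual monomial of [j0],
   so that [(1 - t) * (1 - Q) = Q * (t * (1 - M))]. *)
have Q1 : order_ge X t m.+1 ((1 - t) * (1 - Q)).
  have := order_geMl Q (order_geM (order_ge_exp X t 1) oM); rewrite add1n expr1.
  apply: order_ge_eq => u Xu; have := prod_link Xu.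
  rewrite (bigD1 j0) //= aj0' expr1 => e.
  have jQ : (1 - t).@[u 0] = (1 - t * residual_monomial j0).@[u 0] * Q.@[u 0].
    rewrite -e mevalM (coord_link_equation j0J Xu) aj0 expr1; congr (_ * _).
    by congr (_.@[_]); apply: eq_bigl => k; rewrite [RHS]in_setD1 andbC.
  rewrite [RHS]mevalM [X in _ = _ * X]mevalB [RHS]mulrBr rmorph1 mulr1 {1}jQ.
  by rewrite !(mevalB, mevalM) !rmorph1; ring.
(* [1 - t] is invertible modulo powers of [t]. *)
have Q0 : expands X t m 0 Q.
  rewrite /expands mul0r subr0 -[1 - Q](subrK ((1 - t) * (1 - Q))) addrC.
  apply: order_geD Q1 _.
  rewrite (_ : _ - _ = t * (1 - Q)); last by ring.
  by rewrite -add1n; apply: order_geM (expands_order Qc);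
    exact: (order_ge_exp X t 1).
have /eqP := expands_inj X_irr t_neq0 t_zero Qc Q0.
rewrite sum_nat_eq0 => /forallP/(_ j1); rewrite j1S eqxx mul1n /=.
apply/negP; rewrite -lt0n; have := SJ j1 j1S; rewrite in_setD1 => /andP[ji jL].
by apply: a_gt0; rewrite // eq_sym.
Qed.

End ZeroDimensionalLink.

(** * Faces of a flag complex *)

Section Faces.

Import mathcomp.boot.finset.

Variables (n : nat) (Delta : {set {set 'I_n}}).
Implicit Types F G : {set 'I_n}.
Hypothesis flagD : flag_complex Delta.

Let rank := (\max_(F in Delta) #|F|)%N.

Lemma clique_face G :
  (forall i j, i \in G -> j \in G -> i != j -> compatible Delta i j) ->
  G \in Delta.
Proof.
have [[[F0 F0D] subD] vertD flag] := flagD => cliqueG.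
have [/flag|] := ltnP 2 #|G|; first exact.
case cG: #|G| => [|[|[]]] // _.
- by rewrite (cards0_eq cG); apply: (subD F0) => //; exact: sub0set.
- by move/eqP/cards1P: cG => [i ->].
- move/eqP/cards2P: cG cliqueG => [i [j [ij ->]]] cliqueG.
  by apply: (cliqueG i j); rewrite ?in_set2 ?eqxx ?orbT.
Qed.

Lemma compatible_refl i : compatible Delta i i.
Proof. by rewrite /compatible setUid; case: flagD. Qed.

Lemma compatibleC i j : compatible Delta i j = compatible Delta j i.
Proof. by rewrite /compatible setUC. Qed.

Lemma face_sub F G : F \in Delta -> G \subset F -> G \in Delta.
Proof. by case: flagD => [[_ subD] _ _]; exact: subD. Qed.

Lemma face_compatible F i j : F \in Delta -> i \in F -> j \in F ->
  compatible Delta i j.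
Proof.
by move=> FD iF jF; apply: face_sub FD _; rewrite subUset !sub1set iF.
Qed.

(** Otherwise [i |: F] would be a clique, and cliques of a flag complex are
    faces. *)
Lemma nonface_incompatible F i : F \in Delta -> i |: F \notin Delta ->
  exists2 j, j \in F & ~~ compatible Delta j i.
Proof.
move=> FD /negP iF; apply/exists_inP; apply: contraT => /exists_inPn allc.
case: iF; apply: clique_face.
have ci j : j \in F -> compatible Delta j i by move=> /allc; rewrite negbK.
move=> j k /setU1P[->|jF] /setU1P[->|kF] _; rewrite ?compatible_refl ?ci //.
  by rewrite compatibleC ci.
exact: face_compatible FD jF kF.
Qed.

Lemma facet_nonface F i : facet Delta F -> i \notin F -> i |: F \notin Delta.
Proof.
move=> /andP[_ /forall_inP maxF] iF; apply/negP => /maxF /implyP.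
by rewrite subsetU1 => /(_ isT)/eqP/setP/(_ i); rewrite setU11 (negPf iF).
Qed.

Definition link_vertices G : {set 'I_n} :=
  [set i | (i \notin G) && (i |: G \in Delta)].

Lemma card_face F : F \in Delta -> (#|F| <= rank)%N.
Proof. by move=> FD; exact: leq_bigmax_cond. Qed.

(** Distinct compatible vertices [i] and [j] of the link would make
    [i |: (j |: G)] a clique, hence a face with more than [rank] elements. *)
Lemma link_compatible G i j : G \in Delta -> #|G|.+1 = rank ->
  i \in link_vertices G -> j \in link_vertices G ->
  compatible Delta i j = (i == j).
Proof.
move=> GD Gr; rewrite !inE => /andP[iG iD] /andP[jG jD].
have [->|ij] := eqVneq i j; first exact: compatible_refl.
apply/negP => cij; suff: i |: (j |: G) \in Delta.
  move/card_face; rewrite !cardsU1 !inE (negPf ij) iG jG /=.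
  by rewrite add1n add1n Gr ltnn.
apply/negPn/negP => /(nonface_incompatible jD)[k].
case/setU1P => [->|kG]; first by rewrite compatibleC cij.
by rewrite (face_compatible iD (setU1r _ kG) (setU11 _ _)).
Qed.

(** By purity a facet over [G] has one element more than [G]; conversely
    [i |: G] is maximal because it has the largest possible size. *)
Lemma card_facets_over G : (forall F, facet Delta F -> #|F| = rank) ->
  G \in Delta -> #|G|.+1 = rank ->
  #|[set F : {set 'I_n} | facet Delta F & G \subset F]| = #|link_vertices G|.
Proof.
move=> pureD GD Gr.
rewrite -(card_in_imset (f := fun i => i |: G) (D := link_vertices G));
  last first.
  move=> i j; rewrite !inE => /andP[iG _] _ /setP/(_ i).
  by rewrite !inE eqxx (negPf iG) !orbF => /esym/eqP.
congr #|pred_of_set _|; apply/setP => F; rewrite inE; apply/andP/imsetP.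
  move=> [facF GF]; have := pureD F facF; rewrite -Gr => cF.
  have /cards1P[i iFG] : #|F :\: G| == 1%N.
    by rewrite cardsD (setIidPr GF) cF subSnn.
  have Fi : F = i |: G.
    by rewrite -iFG setUC setDE setUIr setUCr setIT; apply/esym/setUidPr.
  exists i => //; rewrite inE -Fi; have /setDP[_ ->] : i \in F :\: G.
    by rewrite iFG set11.
  by case/andP: facF.
case=> i; rewrite inE => /andP[iG iD] ->; split; last exact: subsetU1.
rewrite /facet iD; apply/forall_inP => H HD; apply/implyP => iH.
rewrite eq_sym eqEcard iH (leq_trans (card_face HD)) //.
by rewrite cardsU1 iG add1n Gr.
Qed.

End Faces.

(** * Strata of a binary geometry *)

Section Strata.

Import mathcomp.boot.finset.

Local Open Scope classical_set_scope.
Local Open Scope ring_scope.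

Variables (K : numFieldType) (n : nat).

Lemma has_dim_inj (X : set 'rV[K]_n) d e : has_dim X d -> has_dim X e -> d = e.
Proof.
by move=> [cd led] [ce lee]; apply/eqP; rewrite eqn_leq lee // led.
Qed.

Lemma has_dim_subsingleton (X : set 'rV[K]_n) d :
  (forall u v, X u -> X v -> u = v) -> has_dim X d -> d = 0%N.
Proof.
move=> X1 [[Z [Zirr Zlt]] _]; case: d => // d in Zirr Zlt *; exfalso.
have [_ [[u Zu] _] Z0X] := Zirr 0%N isT; have [_ _ Z1X] := Zirr 1%N isT.
have [_] := Zlt 0%N isT; apply => v Zv.
by rewrite (X1 v u) //; [exact: Z1X | exact: Z0X].
Qed.

Lemma irreducible_component_self (X : set 'rV[K]_n) :
  irreducible X -> irreducible_component X X.
Proof. by split=> // W _ XW WX; apply/seteqP. Qed.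

Variables (Delta : {set {set 'I_n}}) (U : set 'rV[K]_n).
Hypotheses (flagD : flag_complex Delta) (geomU : binary_geometry Delta U).

Let rank := (\max_(F in Delta) #|F|)%N.
Let stratum (S : {set 'I_n}) : set 'rV[K]_n := U `&` coord_subspace S.

Lemma stratum_irreducible S : S \in Delta -> irreducible (stratum S).
Proof. by move=> SD; have [_ _ /(_ S)[_ /(_ SD)[]]] := geomU. Qed.

(** An irreducible stratum is its own only component, so the codimension
    hypothesis determines its dimension. *)
Lemma stratum_dim S : S \in Delta ->
  exists2 e, has_dim (stratum S) e & (e + #|S|)%N = rank.
Proof.
move=> SD; have [_ [d [dimU dr]] /(_ S)[_ /(_ SD)[irrS codimS]]] := geomU.
have {}dr : d = rank by move: dr; rewrite /complex_dim subrK => -[].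
have [d' [e [dimU' dimS ed]]] := codimS _ (irreducible_component_self irrS).
by exists e; rewrite // ed -dr; apply: has_dim_inj dimU.
Qed.

Lemma geometry_eq : exists2 a : 'I_n -> 'I_n -> nat,
  forall i j, ~~ compatible Delta j i -> (0 < a i j)%N &
  forall u i, U u ->
    u 0 i + \prod_(j | ~~ compatible Delta j i) u 0 j ^+ a i j = 1.
Proof.
have [[a [a_gt0 UE]] _ _] := geomU; exists a => // u i.
rewrite UE => /(_ (binary_equation K Delta a i)) /=.
rewrite /binary_equation mevalB mevalD rmorph1 rmorph_prod /= mevalXU => Ru.
apply/eqP; rewrite -subr_eq0 -[X in _ == X]Ru; last by exists i.
apply/eqP; congr (_ + _ - _); apply: eq_bigr => j _.
by rewrite rmorphXn /= mevalXU.
Qed.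

(** Some [j] in [F] is incompatible with [i]; as [u_j = 0], the product in the
    [i]-th equation vanishes. *)
Lemma stratum_coord1 F i u : F \in Delta -> i |: F \notin Delta ->
  stratum F u -> u 0 i = 1.
Proof.
move=> FD iF [Uu u0]; have [a a_gt0 /(_ u i Uu)] := geometry_eq.
have [j jF cji] := nonface_incompatible flagD FD iF.
by rewrite (bigD1 j) //= (u0 j jF) expr0n eqn0Ngt a_gt0 // mul0r addr0.
Qed.

(** Every coordinate is constant on the stratum of a facet, which is thus a
    point, of dimension zero. *)
Lemma facet_card F : facet Delta F -> #|F| = rank.
Proof.
move=> facF; have /andP[FD _] := facF.
have [e dimF <-] := stratum_dim FD.
suff pt u v : stratum F u -> stratum F v -> u = v.
  by rewrite (has_dim_subsingleton pt dimF).
move=> Fu Fv; apply/rowP => i; have [iF|iF] := boolP (i \in F).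
  by rewrite Fu.2 ?Fv.2.
by rewrite !(stratum_coord1 FD (facet_nonface facF iF)).
Qed.

(** Otherwise the strata of [G] and [i |: G] would coincide, although their
    dimensions differ. *)
Lemma stratum_nsub (G : {set _}) i : i \notin G -> i |: G \in Delta ->
  ~ (forall u, stratum G u -> u 0 i = 0).
Proof.
move=> iG iGD G0; have GD := face_sub flagD iGD (subsetU1 i G).
have [e dimG eG] := stratum_dim GD; have [f dimiG fG] := stratum_dim iGD.
have GE : stratum (i |: G) = stratum G.
  apply/seteqP; split => u [Uu u0]; split => // j jG.
    by apply: u0; rewrite in_setU1 jG orbT.
  by move: jG => /setU1P[->|/u0 //]; apply: G0.
have ef : e = f by apply: has_dim_inj dimG _; rewrite -GE.
move: eG; rewrite -fG -ef cardsU1 iG => /eqP.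
by rewrite eqn_add2l add1n -[X in X == _]addn0 -[X in _ == X]addn1 eqn_add2l.
Qed.

(** On the stratum of [G], a coordinate outside [G] and its link is 1, so the
    equations of the link vertices involve only the link vertices. *)
Lemma card_link_vertices G : G \in Delta -> #|G|.+1 = rank ->
  #|link_vertices Delta G| = 2%N.
Proof.
move=> GD Gr; have [a a_gt0 Ueq] := geometry_eq.
(* A face of size [D - 1] is no facet, so its link has a vertex. *)
have [i iL] : exists i, i \in link_vertices Delta G.
  have [L0|[i iL]] := set_0Vmem (link_vertices Delta G); last by exists i.
  suff : facet Delta G by move/facet_card => /eqP; rewrite -/rank -Gr ltn_eqF.
  rewrite /facet GD; apply/forall_inP => F FD; apply/implyP => GF.
  rewrite eqEsubset GF andbT; apply/fintype.subsetP => j jF.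
  apply: contraT => jG.
  suff : j \in link_vertices Delta G by rewrite L0 in_set0.
  rewrite in_set jG /=; apply: (face_sub flagD FD).
  by rewrite subUset sub1set jF.
have := iL; rewrite in_set => /andP[iG iGD].
apply: (@card_link K n (stratum G) _ a _ _ i iL).
- move=> j k jL kL jk; apply: a_gt0.
  by rewrite (link_compatible flagD GD Gr kL jL) eq_sym.
- move=> u Gu j jL; have := Ueq u j Gu.1.
  rewrite (bigID (mem (link_vertices Delta G))) /= [X in _ * X]big1 ?mulr1.
    move=> e; rewrite -[RHS]e; congr (_ + _); apply: eq_bigl => k.
    rewrite [RHS]andbC.
    apply: andb_id2l => kL.
    by rewrite (link_compatible flagD GD Gr kL jL).
  move=> k /andP[ckj]; rewrite in_set negb_and negbK => /orP[kG|kGD].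
    move: jL ckj; rewrite in_set => /andP[_ jGD].
    by rewrite (face_compatible flagD jGD) ?setU11 // in_setU1 kG orbT.
  by rewrite (stratum_coord1 GD kGD Gu) expr1n.
- exact: stratum_irreducible.
- exact: stratum_nsub.
- have [[p [Up p0]] _] := stratum_irreducible iGD.
  exists p; last by apply: p0; rewrite setU11.
  by split=> // j jG; apply: p0; rewrite in_setU1 jG orbT.
Qed.

End Strata.

Theorem theorem2p10 (R : realType) (n : nat) (Delta : {set {set 'I_n}})
    (U : set 'rV[R[i]]_n) :
  flag_complex Delta -> binary_geometry Delta U -> pseudomanifold Delta.
Proof.
move=> flagD geomU; split.
  by move=> F G /(facet_card flagD geomU) cF /(facet_card flagD geomU) cG;
     rewrite /face_dim cF cG.
move=> G GD dimG; have Gr : #|G|.+1 = (\max_(F in Delta) #|F|)%N.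
  by move: dimG; rewrite /face_dim /complex_dim; lia.
rewrite (card_facets_over _ GD Gr).
  exact: (card_link_vertices flagD geomU).
exact: facet_card flagD geomU.
Qed.
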